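(* Suppose $f$ and its Euclidean gradient are known, $f$ is gradient $L$-Lipschitz on $\operatorname{Conv}(\widetilde{\mathcal M}\cup\mathcal M)$, $f\ge f^\star>-\infty$ on $\mathcal M\cup\widetilde{\mathcal M}$, and the approximate-retraction domain assumption (see context) holds with radius $Q$. Let $\widetilde{\operatorname{grad}}f(r):=\Pi_{\widetilde T_r\widetilde{\mathcal M}}(\nabla f(r))$. Consider the algorithm $x_{i+1}:=\widetilde R_{x_i}(\alpha_i\xi_{x_i})$ started at $x_0\in\widetilde{\mathcal M}$, with $$\xi_{x_i}:=-\widetilde{\operatorname{grad}}f(x_i),\quad \alpha_i:=\min\left\{\frac{Q}{\|\widetilde{\operatorname{grad}}f(x_i)\|},\ \frac1{\widetilde L}\beta_i\right\}>0,\quad \beta_i:=1-\frac{c_{\widetilde{\mathcal M}}\|\nabla f(x_i)\|\sqrt D\,h^m}{\|\widetilde{\operatorname{grad}}f(x_i)\|}>0,$$ and suppose all iterations are performed at points of $\widetilde{\mathcal M}$ where $\widetilde{\mathcal M}$ is a manifold, $h$ is small enough such that $8L_v\le Q$, and $$\max\left\{16\widetilde LL_v,\ 2c_{\widetilde{\mathcal M}}\|\nabla f(x_i)\|\sqrt D\,h^m\right\}\le\|\widetilde{\operatorname{grad}}f(x_i)\|$$ holds for all the iterations. Then for any $\varepsilon>0$, provided enough iterations are performed, the algorithm returns a point $x\in\widetilde{\mathcal M}$ satisfying $f(x)\le f(x_0)$ and $$\|\widetilde{\operatorname{grad}}f(x)\|\le\max\left\{16\widetilde LL_v,\ 2c_{\widetilde{\mathcal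 M}}\|\nabla f(x)\|\sqrt D\,h^m\right\}+\varepsilon=:\varepsilon_3(\widetilde{\mathcal M}).\tag{a}$$ In addition, for the point $p\in\mathcal M$ such that $\mathcal P_m^h(p)=x$, $$\|\operatorname{grad}_{\mathcal M}f(p)\|\le(c_{\mathcal M}G+c_{\mathrm{MMLS}})\sqrt D\,h^m+\varepsilon_3(\widetilde{\mathcal M}),\tag{b}$$ where $\|\nabla f(x)\|\le G$, and $\|p-x\|\le c_{\mathrm{MMLS}}\sqrt D\,h^{m+1}$. Moreover, when $h\to0$ the bound in (b) goes to $\varepsilon$, and the quantities $8L_v$ and $\max\{16\widetilde LL_v,\ 2c_{\widetilde{\mathcal M}}\|\nabla f(x_i)\|\sqrt D\,h^m\}$ go to $0$. Finally, if $\varepsilon_3(\widetilde{\mathcal M})>2Q\widetilde L$, the bounds (a) and (b) are achieved in at most $$\left\lceil\frac{16(f(x_0)-f^\star)}{Q}\cdot\frac1{\varepsilon_3(\widetilde{\mathcal M})}\right\rceil$$ iterations, and if $\varepsilon_3(\widetilde{\mathcal M})\le2Q\widetilde L$, they are achieved in at most $$\left\lceil32(f(x_0)-f^\star)\widetilde L\cdot\frac1{\varepsilon_3(\widetilde{\mathcal M})^2}\right\rceil$$ iterations. Each iteration requires one cost and approximate-Riemannian gradient evaluation, and one approximate-retraction computation.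
   Context: Norms: $\|\cdot\|$ is the Euclidean norm on vectors and the spectral norm on matrices; $B_\delta(x)$ is the open ball; $\Pi_V$ is orthogonal projection onto $V$. ''Gradient $L$-Lipschitz on $\operatorname{Conv}(\widetilde{\mathcal M}\cup\mathcal M)$'' means $\|\nabla f(y)-\nabla f(x)\|\le L\|y-x\|$ for all $x,y$ in the convex hull of $\widetilde{\mathcal M}\cup\mathcal M$. $f:\mathbb R^D\to\mathbb R$. Setting. $\mathcal M$ ($\in C^2$) is a closed (compact, boundaryless) smooth $d$-dimensional submanifold of $\mathbb R^D$ with positive reach $\mathrm{rch}(\mathcal M)$ (the largest $\tau$ such that every point at distance $<\tau$ from $\mathcal M$ has a unique nearest point in $\mathcal M$). $S=\{r_i\}_{i=1}^n\subset\mathcal M$ is a quasi-uniform sample set with respect to $\mathcal M$: with fill distance $h=\sup_{x\in\mathcal M}\min_i\|x-r_i\|$ and separation radius $\delta_S=\tfrac12\min_{i\ne j}\|r_i-r_j\|$, one has $\delta_S\le h\le c_{qu}\delta_S$ for a constant $c_{qu}>0$. The metric is the standard inner product of $\mathbb R^D$; $\operatorname{grad}_{\mathcal M}f(p)=\Pi_{T_p\mathcal M}(\nabla f(p))$, $\operatorname{grad}_{\widetilde{\mathcal M}}f(r)=\Pi_{T_r\widetilde{\mathcal M}}(\nabla f(r))$. MMLS projection of degree $m\ge1$. For $r\in\mathbb R^D$ close to $\mathcal M$: Step 1: $(q(r),H(r))$ minimizes $\sum_i d(r_i-q,H)^2\theta_1(\|r_i-q\|)$ over $q\in\mathbb R^D$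 and $d$-dimensional linear subspaces $H\subset\mathbb R^D$, subject to $r-q\perp H$, $q\in B_\mu(r)$, $S\cap B_h(q)\ne\emptyset$. Step 2: let $q_i$ be the orthogonal projection of $r_i-q(r)$ onto $H(r)\simeq\mathbb R^d$; $g^\star(\cdot\,|\,r):H(r)\to\mathbb R^D$ minimizes $\sum_i\|g(q_i)-r_i\|^2\theta_h(\|r_i-q(r)\|)$ over $\mathbb R^D$-valued polynomials of total degree at most $m$. Then $\mathcal P_m^h(r):=g^\star(0\,|\,r)$ and $\widetilde{\mathcal M}:=\{\mathcal P_m^h(p):p\in\mathcal M\}$. Weights: $\theta_1,\theta_h\ge0$, $\theta_h(th)=\Phi(t)$ for a fixed $\Phi$; they are smooth (away from singularities at $0$), monotonically decaying, supported on $[0,c_1h]$ with $c_1>3$, $\theta_1(c_2h)>c_3>0$ and $\theta_h(c_2h)>c_3>0$ for some constants $c_2<c_1$, $\lim_{t\to0}\theta_h(t)=\infty$, and $\mu=\mathrm{rch}(\mathcal M)/2$. It is assumed that there is an $\epsilon$-neighborhood of $\mathcal M$ on which the Step 1 problem has a unique local minimum $q(x)\in B_\mu(x)$; $U_{\mathrm{unique}}$ is the largest such neighborhood. $h$ is assumed small enough (including $hL\le1$) for the known facts: $\mathcal P_m^h:\mathcal M\to\widetilde{\mathcal M}$ is a bijection; $\widetilde{\mathcal M}$ is compact and almost everywhere a smooth $d$-dimensional manifold; $\mathcal P_m^h(U_{\mathrm{unique}})\subset\widetilde{\mathcal M}$; if $p\in\mathcal M$, $\mathcal P_m^h(p)=r$,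 then $q(r)=q(p)$, $H(r)=H(p)$, $g^\star(\cdot|r)=g^\star(\cdot|p)$, $\mathcal P_m^h(r)=r$. Local parametrizations: near $0\in H(p)$, $\varphi$ and $\widetilde\varphi$ are the local parametrizations of $\mathcal M$ and $\widetilde{\mathcal M}$ sending $x$ to the nearby point $y$ of the set for which $y-q(p)$ projects orthogonally onto $x$ in $H(p)$; $\varphi(0)=p$, $\widetilde\varphi(0)=\mathcal P_m^h(p)$. Constants (independent of $p$, $v$): $c_{\mathrm{MMLS}}$ satisfies $\|\mathcal P_m^h(p)-p\|\le c_{\mathrm{MMLS}}\sqrt D\,h^{m+1}$ for all $p\in\mathcal M$; $c_{\mathcal M},c_{\widetilde{\mathcal M}}$ satisfy, for all $p\in\mathcal M$, $x\in B_{c_1h}(0)\subset H(p)$, unit $v\in\mathbb R^d$: $\|\mathrm Dg^\star(x|p)[v]-\mathrm D\varphi(x)[v]\|_\infty\le c_{\mathcal M}h^m$ and $\|\mathrm Dg^\star(x|p)[v]-\mathrm D\widetilde\varphi(x)[v]\|_\infty\le c_{\widetilde{\mathcal M}}h^m$. Approximate components: $\widetilde T_r\widetilde{\mathcal M}:=\operatorname{Range}(\mathrm Dg^\star(0\,|\,r))$ for $r\in\widetilde{\mathcal M}$; $\widetilde R_r(\xi):=\mathcal P_m^h(r+\xi)$ for $\xi\in\widetilde T_r\widetilde{\mathcal M}$. Approximate-retraction domain assumption: for each $r\in\widetilde{\mathcal M}$ there is $Q_r>0$ with $r+\xi\in U_{\mathrm{unique}}$ for all $\xi\in\widetilde T_r\widetilde{\mathcal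 M}$, $\|\xi\|\le Q_r$, and $Q:=\inf_rQ_r>0$; $K:=\{(r,\xi):r\in\widetilde{\mathcal M},\xi\in\widetilde T_r\widetilde{\mathcal M},\|\xi\|\le Q\}$ (compact). For $(r,\xi)\in K$, $\mathrm D\widetilde R_r(0_r)[\xi]=\xi+v'_{r,\xi}(0)\in T_r\widetilde{\mathcal M}$, where $v_{r,\xi}(t)\in H(r+t\xi)^\perp$ is smooth in $t$ near $0$ with $t\xi+v_{r,\xi}(t)\in T_r\widetilde{\mathcal M}$; $L_v>0$ is a constant with $\|v'_{r,\xi}(0)\|\le L_v$ on $K$, and $L_v\to0$ as $h\to0$. $\widetilde L>0$ is a constant with $|f(\widetilde R_r(\xi))-[f(r)+\langle\operatorname{grad}_{\widetilde{\mathcal M}}f(r),\xi+v'_{r,\xi}(0)\rangle]|\le\frac{\widetilde L}2\|\xi\|^2$ for all $(r,\xi)\in K$. $G$ is a finite bound of $\|\nabla f\|$ on $\widetilde{\mathcal M}$.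
   Formalization: In the two iteration bounds, ε_3 is replaced by any e>0 with e ≤ ε_3 evaluated at every iterate where an iteration is performed (ε_3 depends on x through ‖∇f(x)‖; with its value at the returned point the bounds can fail). *)

(* Defs.v *)
From HB Require Import structures.
From mathcomp Require Import all_boot all_order all_algebra.
From mathcomp Require Import -(notations) mpoly.
From mathcomp Require Import all_classical all_reals all_analysis.
Set Implicit Arguments.
Unset Strict Implicit.
Unset Printing Implicit Defensive.
Import Order.TTheory GRing.Theory Num.Theory numFieldNormedType.Exports.
Local Open Scope classical_set_scope.
Local Open Scope ring_scope.

(* The library's norm [`|u|] on ['rV_D] is the maximum norm; it induces the
   usual topology and is used below only where the sup norm is meant. *)
Section Euclid.
Context {R : realType} {D : nat}.
Implicit Types (u v x y : 'rV[R]_D) (A V : set 'rV[R]_D) (f : 'rV[R]_D -> R).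

Definition dot u v : R := \sum_i u 0 i * v 0 i.
Definition enorm u : R := Num.sqrt (dot u u).
Definition eball x (r : R) : set 'rV[R]_D := [set y | enorm (y - x) < r].
Definition dist_to A x : R := inf [set enorm (x - y) | y in A].

Definition carrier (H : {vspace 'rV[R]_D}) : set 'rV[R]_D := [set u | u \in H].

Definition orthogonal_to u V : Prop := forall z, V z -> dot u z = 0.

(* For a linear subspace V there is exactly one such w. *)
Definition orthproj V u : 'rV[R]_D := xget 0 [set w | V w /\ orthogonal_to (u - w) V].

Definition egrad f x : 'rV[R]_D := \row_j 'D_(delta_mx 0 j) f x.

Definition conv_hull A : set 'rV[R]_D :=
  \bigcap_(C in [set C : set 'rV[R]_D | convex_set C /\ A `<=` C]) C.

Definition grad_lipschitz_on A f (L : R) : Prop :=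
  (forall x, A x -> differentiable f x) /\
  (forall x y, A x -> A y -> enorm (egrad f y - egrad f x) <= L * enorm (y - x)).

(* Real-valued: for a closed submanifold of positive dimension the set below is
   bounded. *)
Definition reach A : R :=
  sup [set tau : R | 0 <= tau /\ forall x, dist_to A x < tau ->
         exists! y, A y /\ enorm (x - y) = dist_to A x].

Definition tube A (e : R) : set 'rV[R]_D := [set x | dist_to A x < e].

(* Vanishing d-dimensional Hausdorff measure, for d > 0 (the radii are then
   automatically small). *)
Definition hausdorff_null (d : nat) A : Prop :=
  forall e : R, 0 < e -> exists (c : nat -> 'rV[R]_D) (s : nat -> R),
    [/\ forall n, 0 <= s n, A `<=` \bigcup_n eball (c n) (s n) &
        forall N, \sum_(n < N) s n ^+ d <= e].

(* R^D-valued polynomial maps of total degree at most m. *)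
Definition poly_map (m : nat) (g : 'rV[R]_D -> 'rV[R]_D) : Prop :=
  exists p : 'I_D -> mpoly D R,
    (forall j, (mpoly.msize (p j) <= m.+1)%N) /\
    forall x, g x = \row_j meval (fun i => x 0 i) (p j).

End Euclid.

Section Submanifolds.
Context {R : realType}.

(* Meant for open U. *)
Fixpoint Ck {V W : normedModType R} (k : nat) (f : V -> W) (U : set V) : Prop :=
  if k is k'.+1
  then (forall x, U x -> differentiable f x) /\
       (forall v, Ck k' (fun x => 'D_v f x) U)
  else forall x, U x -> {for x, continuous f}.

(* [Some k] stands for C^k, [None] for C^oo. *)
Definition Creg {V W : normedModType R} (k : option nat) (f : V -> W) (U : set V) :=
  if k is Some k' then Ck k' f U else forall k', Ck k' f U.

Context {D : nat}.
Implicit Types (A : set 'rV[R]_D) (p : 'rV[R]_D).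

(* Near p, the set A is an embedded C^k submanifold of dimension d: psi is a
   regular parametrization of a relatively open part of A, with continuous
   inverse chi. *)
Definition manifold_point (k : option nat) (d : nat) A p : Prop :=
  A p /\
  exists (U : set 'rV[R]_D) (W : set 'rV[R]_d)
         (psi : 'rV[R]_d -> 'rV[R]_D) (chi : 'rV[R]_D -> 'rV[R]_d),
    [/\ open U /\ U p, open W, Creg k psi W,
        (forall w, W w -> injective ('d psi w)) &
        [/\ psi @` W = A `&` U, (forall w, W w -> chi (psi w) = w) &
            {within A `&` U, continuous chi}]].

Definition closed_submanifold (k : option nat) (d : nat) A : Prop :=
  [/\ A !=set0, compact A & forall p, A p -> manifold_point k d A p].

(* Velocities at p of curves in A. *)
Definition tangent A p : set 'rV[R]_D :=
  [set v | exists gam : R -> 'rV[R]_D,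
     [/\ gam 0 = p, \forall t \near (0 : R), A (gam t) &
         is_derive (0 : R) (1 : R) gam v]].

Definition rgrad (f : 'rV[R]_D -> R) A p : 'rV[R]_D := orthproj (tangent A p) (egrad f p).

End Submanifolds.

(* Weights take values in \bar R because they are infinite at 0.  The products
   below use the convention 0 * +oo = 0, so an infinite mmls_weight forces the
   corresponding residual to vanish. *)
Record mmls (R : realType) (D : nat) := MMLS {
  manifold : set 'rV[R]_D;
  mdim : nat;
  degree : nat;
  samples : seq 'rV[R]_D;
  theta1 : R -> \bar R;
  Phi : R -> \bar R
}.

Section MMLS.
Context {R : realType} {D : nat}.
Variable P : mmls R D.
Local Notation E := 'rV[R]_D.
Local Notation M := (manifold P).
Local Notation d := (mdim P).
Local Notation m := (degree P).
Local Notation S := (samples P).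
Implicit Types (p q r x xi : E) (H : {vspace E}) (g : E -> E).

Definition fill_dist : R := sup [set dist_to [set` S] x | x in M].
Definition separation : R :=
  2^-1 * inf [set enorm (z.1 - z.2) | z in [set z : E * E |
                [/\ z.1 \in S, z.2 \in S & z.1 != z.2]]].
Definition thetah (t : R) : \bar R := Phi P (t / fill_dist).
Definition mu : R := reach M / 2.

Definition step1_feasible r q H : Prop :=
  [/\ \dim H = d, orthogonal_to (r - q) (carrier H), eball r mu q &
      exists2 s, s \in S & eball q fill_dist s].
Definition step1_cost q H : \bar R :=
  (\sum_(s <- S) (dist_to (carrier H) (s - q) ^+ 2)%:E * theta1 P (enorm (s - q)))%E.
Definition step1_min r q H : Prop :=
  step1_feasible r q H /\
  forall q' H', step1_feasible r q' H' -> (step1_cost q H <= step1_cost q' H')%E.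

(* Local minimality of q refers to the cost minimized over the admissible H. *)
Definition step1_reduced_cost r q : \bar R :=
  ereal_inf [set step1_cost q H | H in step1_feasible r q].
Definition step1_local_min r q : Prop :=
  (exists H, step1_feasible r q H) /\
  exists2 e : R, 0 < e & forall q', (exists H, step1_feasible r q' H) ->
    eball q e q' -> (step1_reduced_cost r q <= step1_reduced_cost r q')%E.

Definition step1_unique r : Prop :=
  exists q H, step1_min r q H /\ forall q', step1_local_min r q' <-> q' = q.
Definition Uunique : set E :=
  \bigcup_(e in [set e : R | 0 < e /\ tube M e `<=` step1_unique]) tube M e.

Definition step1_sol r : E * {vspace E} :=
  xget (0, 0%VS) [set qH | step1_min r qH.1 qH.2].
Definition qof r : E := (step1_sol r).1.
Definition Hof r : {vspace E} := (step1_sol r).2.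
Definition projH r : E -> E := orthproj (carrier (Hof r)).

(* Maps on H(r) are represented by maps on the whole space, of which only the
   restriction to H(r) matters; the polynomials of degree at most m on H(r) are
   the restrictions of those on R^D. *)
Definition step2_cost r g : \bar R :=
  (\sum_(s <- S) (enorm (g (projH r (s - qof r)) - s) ^+ 2)%:E
                 * thetah (enorm (s - qof r)))%E.
Definition step2_min r g : Prop :=
  poly_map m g /\ forall g', poly_map m g' -> (step2_cost r g <= step2_cost r g')%E.
Definition gstar r : E -> E := xget (fun=> 0) (step2_min r).

Definition proj_mmls r : E := gstar r 0.
Definition Mt : set E := proj_mmls @` M.

(* Directional derivatives along H(r) only involve values on H(r). *)
Definition atangent r : set E := [set 'D_v (gstar r) 0 | v in carrier (Hof r)].
Definition aretr r xi : E := proj_mmls (r + xi).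
Definition agrad (f : E -> R) r : E := orthproj (atangent r) (egrad f r).

Definition Mt_smooth : set E := manifold_point None d Mt.

Definition mmls_weight (c1 c2 c3 : R) (theta : R -> \bar R) : Prop :=
  [/\ (forall t, 0 <= t -> (0 <= theta t)%E),
      (forall t, 0 < t -> theta t \is a fin_num) /\
        Creg None (fun t : R => fine (theta t) : R) [set t | 0 < t],
      (forall s t, 0 <= s -> s <= t -> (theta t <= theta s)%E),
      (forall t, c1 * fill_dist < t -> theta t = 0%E) &
      (c3%:E < theta (c2 * fill_dist)%R)%E].

Record mmls_setting (c1 c2 c3 cqu : R) : Prop := {
  set_dim : (0 < d)%N;
  set_degree : (1 <= m)%N;
  set_manifold : closed_submanifold (Some 2%N) d M;
  set_reach : 0 < reach M;
  set_samples : [/\ uniq S, (2 <= size S)%N & [set` S] `<=` M];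
  set_quasi_uniform : 0 < cqu /\ separation <= fill_dist <= cqu * separation;
  set_consts : [/\ 3 < c1, 0 < c2 < c1 & 0 < c3];
  set_theta1 : mmls_weight c1 c2 c3 (theta1 P);
  set_thetah : mmls_weight c1 c2 c3 thetah;
  set_thetah_lim : thetah t @[t --> (0 : R)^'+] --> +oo%E;
  set_unique : exists2 e : R, 0 < e & tube M e `<=` step1_unique
}.

Record small_fill_facts : Prop := {
  fact_bij : set_bij M Mt proj_mmls;
  fact_compact : compact Mt;
  fact_ae_manifold : hausdorff_null d (Mt `\` Mt_smooth);
  fact_range : proj_mmls @` Uunique `<=` Mt;
  fact_q : forall p, M p -> qof (proj_mmls p) = qof p;
  fact_H : forall p, M p -> Hof (proj_mmls p) = Hof p;
  fact_g : forall p, M p -> forall x, x \in Hof p -> gstar (proj_mmls p) x = gstar p x;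
  fact_idem : forall p, M p -> proj_mmls (proj_mmls p) = proj_mmls p
}.

(* phi : H(p) -> R^D is the local parametrization of A around y0, as a graph over
   the ball of retr_radius rho in H(p).  Differentiability is required only over the
   points where A is a manifold (of class C^k). *)
Definition graph_param (k : option nat) (rho : R) (A : set E) p (y0 : E) (phi : E -> E) : Prop :=
  [/\ phi 0 = y0,
      (forall x, x \in Hof p -> enorm x < rho ->
         A (phi x) /\ projH p (phi x - qof p) = x),
      (exists2 e : R, 0 < e &
         forall y, A y -> enorm (y - y0) < e -> phi (projH p (y - qof p)) = y) &
      (forall x, x \in Hof p -> enorm x < rho -> manifold_point k d A (phi x) ->
         differentiable (fun y => phi (projH p y)) x)].

Definition deriv_close (k : option nat) (rho c : R) (A : set E) p (phi : E -> E) : Prop :=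
  forall x v, x \in Hof p -> enorm x < rho -> v \in Hof p -> enorm v = 1 ->
    manifold_point k d A (phi x) ->
    `| 'D_v (gstar p) x - 'D_v phi x | <= c * fill_dist ^+ m.

Record mmls_approximation (c1 cMMLS cM cMt : R) (phi phit : E -> E -> E) : Prop := {
  approx_proj : forall p, M p ->
    enorm (proj_mmls p - p) <= cMMLS * Num.sqrt D%:R * fill_dist ^+ m.+1;
  approx_phi : forall p, M p -> graph_param (Some 2%N) (c1 * fill_dist) M p p (phi p);
  approx_phit : forall p, M p -> graph_param None (c1 * fill_dist) Mt p (proj_mmls p) (phit p);
  approx_M : forall p, M p -> deriv_close (Some 2%N) (c1 * fill_dist) cM M p (phi p);
  approx_Mt : forall p, M p -> deriv_close None (c1 * fill_dist) cMt Mt p (phit p)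
}.

Definition retr_radius (Qr : E -> R) : R := inf [set Qr r | r in Mt].

Definition aretr_domain (Qr : E -> R) : Prop :=
  (forall r, Mt r -> 0 < Qr r /\
     forall xi, atangent r xi -> enorm xi <= Qr r -> Uunique (r + xi)) /\
  0 < retr_radius Qr.

Definition Kset (Q : R) : set (E * E) :=
  [set z | [/\ Mt z.1, atangent z.1 z.2 & enorm z.2 <= Q]].

(* T_r Mt, hence everything here, makes sense only where Mt is a manifold. *)
Record aretr_regular (Q Lv Lt : R) (f : E -> R) (v : E -> E -> R -> E) : Prop := {
  reg_Lv : 0 < Lv;
  reg_Lt : 0 < Lt;
  reg_v_smooth : forall r xi, Kset Q (r, xi) -> Mt_smooth r ->
    exists2 e : R, 0 < e &
      Creg None (v r xi) [set t : R | `|t| < e] /\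
      forall t, `|t| < e ->
        orthogonal_to (v r xi t) (carrier (Hof (r + t *: xi))) /\
        tangent Mt r (t *: xi + v r xi t);
  reg_deriv : forall r xi, Kset Q (r, xi) -> Mt_smooth r ->
    is_derive (0 : R) (1 : R) (fun t : R => aretr r (t *: xi)) (xi + derive1 (v r xi) 0) /\
    tangent Mt r (xi + derive1 (v r xi) 0);
  reg_v_bound : forall r xi, Kset Q (r, xi) -> Mt_smooth r -> enorm (derive1 (v r xi) 0) <= Lv;
  reg_taylor : forall r xi, Kset Q (r, xi) -> Mt_smooth r ->
    `| f (aretr r xi) - (f r + dot (rgrad f Mt r) (xi + derive1 (v r xi) 0)) |
      <= Lt / 2 * enorm xi ^+ 2
}.

End MMLS.

(* In what follows G and g stand for the Euclidean gradient and the approximate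
   Riemannian gradient at the current point, and kap for c sqrt(D) h^m. *)
Section Iteration.
Context {R : realType} {D : nat}.
Variables (Q Lt kap : R).
Local Notation E := 'rV[R]_D.

Definition beta_of (G g : E) : R := 1 - enorm G * kap / enorm g.
Definition alpha_of (G g : E) : R := Num.min (Q / enorm g) (Lt^-1 * beta_of G g).

(* Programs that can access the problem only through three oracles. *)
Inductive oracle_prog (A : Type) : Type :=
| Return of A
| AskCost of E & (R -> oracle_prog A)
| AskGrad of E & (E * E -> oracle_prog A)
| AskRetr of E & E & (E -> oracle_prog A).

(* The step from x also evaluates the cost of the new iterate. *)
Definition iteration_prog (x : E) : oracle_prog (E * R) :=
  AskGrad x (fun Gg =>
  AskRetr x (alpha_of Gg.1 Gg.2 *: - Gg.2) (fun y =>
  AskCost y (fun c => Return (y, c)))).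

End Iteration.

Section Oracles.
Context {R : realType} {D : nat}.
Local Notation E := 'rV[R]_D.
Variables (cost : E -> R) (grads : E -> E * E) (retr : E -> E -> E).

(* Result, and numbers of cost, gradient and retraction queries. *)
Fixpoint run_prog (A : Type) (pr : oracle_prog A) : A * (nat * nat * nat) :=
  match pr with
  | Return a => (a, (0, 0, 0))
  | AskCost x k => let: (a, (nc, ng, nr)) := run_prog (k (cost x)) in (a, (nc.+1, ng, nr))
  | AskGrad x k => let: (a, (nc, ng, nr)) := run_prog (k (grads x)) in (a, (nc, ng.+1, nr))
  | AskRetr x xi k => let: (a, (nc, ng, nr)) := run_prog (k (retr x xi)) in (a, (nc, ng, nr.+1))
  end%N.

End Oracles.

Section Algorithm.
Context {R : realType} {D : nat}.
Variables (P : mmls R D) (f : 'rV[R]_D -> R) (cMt Q Lt Lv : R).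
Local Notation E := 'rV[R]_D.
Implicit Types (x : nat -> E).

Definition kappa : R := cMt * Num.sqrt D%:R * fill_dist P ^+ degree P.
Definition step_beta (z : E) : R := beta_of kappa (egrad f z) (agrad P f z).
Definition step_alpha (z : E) : R := alpha_of Q Lt kappa (egrad f z) (agrad P f z).
Definition next_iterate (z : E) : E := aretr P z (step_alpha z *: - agrad P f z).

Definition noise_level (z : E) : R :=
  Num.max (16 * Lt * Lv)
          (2 * cMt * enorm (egrad f z) * Num.sqrt D%:R * fill_dist P ^+ degree P).
Definition eps3 (eps : R) (z : E) : R := noise_level z + eps.
Definition bound_a (eps : R) (z : E) : Prop := enorm (agrad P f z) <= eps3 eps z.

Definition bound_b_rhs (cM cMMLS G eps : R) (z : E) : R :=
  (cM * G + cMMLS) * Num.sqrt D%:R * fill_dist P ^+ degree P + eps3 eps z.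

(* The algorithm returns the first iterate satisfying [bound_a]; iteration i, from x i
   to x i.+1, is performed if nothing has been returned among x 0, ..., x i. *)
Definition mmls_performed (eps : R) x (i : nat) : Prop :=
  forall j, (j <= i)%N -> ~ bound_a eps (x j).

(* A run with a budget of T iterations from x0, every performed iteration of which
   satisfies the standing requirements. *)
Definition mmls_run (eps : R) (x0 : E) (T : nat) x : Prop :=
  x 0%N = x0 /\
  forall i, (i < T)%N -> mmls_performed eps x i ->
    [/\ Mt_smooth P (x i), 0 < step_beta (x i), 0 < step_alpha (x i),
        noise_level (x i) <= enorm (agrad P f (x i)) &
        x i.+1 = next_iterate (x i)].

Definition mmls_returned (cM cMMLS G eps : R) x (k : nat) : Prop :=
  [/\ (forall j, (j < k)%N -> ~ bound_a eps (x j)), bound_a eps (x k),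
      Mt P (x k), f (x k) <= f (x 0%N) &
      forall p, manifold P p -> proj_mmls P p = x k ->
        [/\ enorm (rgrad f (manifold P) p) <= bound_b_rhs cM cMMLS G eps (x k),
            enorm (egrad f (x k)) <= G &
            enorm (p - x k) <= cMMLS * Num.sqrt D%:R * fill_dist P ^+ (degree P).+1]].

End Algorithm.

(* The filter "h i tends to 0" on the index set of a family. *)
Definition to0 {R : realType} {I : Type} (h : I -> R) : set_system I :=
  filter_from [set e : R | 0 < e] (fun e => [set i | h i < e]).

(* Main.v *)
Require Import Defs.
From HB Require Import structures.
From mathcomp Require Import all_boot all_order all_algebra.
From mathcomp Require mpoly.
From mathcomp Require Import all_classical all_reals all_analysis.
From mathcomp Require Import ring lra.
Set Implicit Arguments.
Unset Strict Implicit.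
Unset Printing Implicit Defensive.
Import Order.TTheory GRing.Theory Num.Theory numFieldNormedType.Exports.
Local Open Scope classical_set_scope.
Local Open Scope ring_scope.

(** At an iterate x let g be the approximate Riemannian gradient, gam = |g|,
    N the norm of the Euclidean gradient G, T' the approximate tangent space,
    T the true one and kap = c sqrt(D) h^m.

    Descent.  The quadratic model of f along the approximate retraction needs
    <G, w> for the true velocity w = xi + v', where xi = - alpha g lies in T'
    and |v'| <= Lv.  Since G - g is orthogonal to T', it sees w only through
    the distance from w to T', and this distance is at most kap |w|: both T'
    and T are images of H by derivatives of maps that are kap-close, and the
    derivative of a graph over H does not decrease norms.  Hence
      <G, w> <= - alpha gam^2 + gam Lv + N kap (alpha gam + Lv)
             <= - alpha gam^2 beta + (3/2) gam Lv
    ([tangent_gap], [tilted_dot]).  Only the one-sided gap from T to T' enters;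
    the derivative of the polynomial may decrease norms, so this is the side
    that the hypotheses control.
    Inserting the two values of the step size, with beta >= 1/2, 8 Lv <= Q and
    16 Lt Lv <= gam, a step decreases f by at least Q gam / 16 or by
    gam^2 / (32 Lt), the latter only when gam <= 2 Q Lt ([step_decrease],
    [iterate_step]).

    Complexity.  As long as nothing is returned, gam exceeds eps3, so that
    every step decreases f by more than a fixed amount; f is bounded below,
    which limits the number of steps ([returned_in_time]).

    Gradient on the manifold.  The argument for the descent, applied to the
    tangent space at p and to the vector w = grad_M f (p), bounds <G, w>; the
    change of the Euclidean gradient between p and x is at most L |p - x|, and
    h L <= 1 ([enorm_rgrad_M]).

    Tangent spaces are sets of velocities, so that they have to be shown to be
    linear before projections on them make sense.  This follows from the graph
    parametrization phi over H(p): with F = phi o proj_H, the tangent space is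
    the range of the derivative of F at 0, which moreover fixes it
    ([tangent_graph_fixed], [graph_ext_tangent]). *)

(** * Euclidean geometry of row vectors *)

Section EuclideanSpace.
Context {R : realType} {D : nat}.
Local Notation E := 'rV[R]_D.
Implicit Types (u v w x y : E) (H : {vspace E}).

Lemma dotC u v : dot u v = dot v u.
Proof. by apply: eq_bigr => i _; rewrite mulrC. Qed.

Lemma dotDl u v w : dot (u + v) w = dot u w + dot v w.
Proof. by rewrite /dot -big_split; apply: eq_bigr => i _; rewrite !mxE mulrDl. Qed.

Lemma dotZl (a : R) u w : dot (a *: u) w = a * dot u w.
Proof. by rewrite /dot mulr_sumr; apply: eq_bigr => i _; rewrite !mxE mulrA. Qed.

Lemma dotNl u w : dot (- u) w = - dot u w.
Proof. by rewrite -scaleN1r dotZl mulN1r. Qed.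

Lemma dotDr u v w : dot w (u + v) = dot w u + dot w v.
Proof. by rewrite dotC dotDl !(dotC w). Qed.

Lemma dotZr (a : R) u w : dot w (a *: u) = a * dot w u.
Proof. by rewrite dotC dotZl (dotC w). Qed.

Lemma dotNr u w : dot w (- u) = - dot w u.
Proof. by rewrite dotC dotNl (dotC w). Qed.

Lemma dot0l w : dot 0 w = 0.
Proof. by rewrite -(scale0r (0 : E)) dotZl mul0r. Qed.

Definition dotE := (dotDl, dotDr, dotNl, dotNr, dotZl, dotZr).

Lemma dot_ge0 u : 0 <= dot u u.
Proof. by apply: sumr_ge0 => i _; exact: sqr_ge0. Qed.

Lemma dot_eq0 u : dot u u = 0 -> u = 0.
Proof.
move/eqP; rewrite psumr_eq0 => [/allP u0|i _]; last exact: sqr_ge0.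
apply/rowP => i; have := u0 i (mem_index_enum _).
by rewrite mxE /= mulf_eq0 orbb => /eqP.
Qed.

Lemma enorm_ge0 u : 0 <= enorm u.
Proof. exact: sqrtr_ge0. Qed.

Lemma enorm_sqr u : enorm u ^+ 2 = dot u u.
Proof. by rewrite sqr_sqrtr // dot_ge0. Qed.

Lemma enorm_eq0 u : enorm u = 0 -> u = 0.
Proof. by move=> u0; apply: dot_eq0; rewrite -enorm_sqr u0 expr0n. Qed.

Lemma enorm0 : enorm (0 : E) = 0.
Proof. by rewrite /enorm dot0l sqrtr0. Qed.

Lemma enormZ (a : R) u : enorm (a *: u) = `|a| * enorm u.
Proof.
by rewrite /enorm dotZl dotZr mulrA -expr2 sqrtrM ?sqr_ge0 // sqrtr_sqr.
Qed.

Lemma enormN u : enorm (- u) = enorm u.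
Proof. by rewrite -scaleN1r enormZ normrN1 mul1r. Qed.

Lemma enormBC u v : enorm (u - v) = enorm (v - u).
Proof. by rewrite -enormN opprB. Qed.

Lemma enorm_le u v : dot u u <= dot v v -> enorm u <= enorm v.
Proof. exact: ler_wsqrtr. Qed.

Lemma dot_le_enormM u v : dot u v <= enorm u * enorm v.
Proof.
have [v0|v0] := eqVneq (enorm v) 0.
  by rewrite (enorm_eq0 v0) dotC dot0l enorm0 mulr0.
have vpos : 0 < enorm v by rewrite lt_def v0 enorm_ge0.
have [u0|u0] := eqVneq (enorm u) 0.
  by rewrite (enorm_eq0 u0) dot0l enorm0 mul0r.
have upos : 0 < enorm u by rewrite lt_def u0 enorm_ge0.
have := dot_ge0 (enorm v *: u - enorm u *: v).
rewrite !dotE -!enorm_sqr (dotC v u) => h.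
have : 0 <= (enorm u * enorm v) * (enorm u * enorm v - dot u v) by nra.
by rewrite pmulr_rge0 ?mulr_gt0 // subr_ge0.
Qed.

Lemma enormD u v : enorm (u + v) <= enorm u + enorm v.
Proof.
rewrite -(@ler_pXn2r _ 2) ?nnegrE ?addr_ge0 ?enorm_ge0 //.
rewrite sqrrD !enorm_sqr !dotE (dotC v u).
by have := dot_le_enormM u v; lra.
Qed.

Lemma enorm_le_sup u : enorm u <= Num.sqrt D%:R * `|u|.
Proof.
rewrite -[`|u|]ger0_norm ?normr_ge0 // -sqrtr_sqr -sqrtrM ?ler0n //.
apply: ler_wsqrtr; rewrite mulrC -[D in D%:R]card_ord mulr_natr -sumr_const.
apply: ler_sum => i _; rewrite -expr2 -real_normK ?num_real //.
rewrite lerXn2r ?nnegrE ?normr_ge0 //.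
rewrite [leRHS](@mx_normrE _ 1 D u).
exact: (le_bigmax _ (fun ij => `|u ij.1 ij.2|) (0, i)).
Qed.

(** Gram-Schmidt: the residual e of a new spanning vector x is orthogonal to the
    span of the others, so the projection only has to be corrected along e. *)
Lemma orthogonal_projection_exists H u :
  exists w, w \in H /\ orthogonal_to (u - w) (carrier H).
Proof.
have [X ->] : exists X : seq E, H = <<X>>%VS.
  by exists (vbasis H); rewrite (span_basis (vbasisP H)).
elim: X u => [|x X IH] u.
  exists 0; split; first exact: mem0v.
  by move=> z; rewrite /carrier /= span_nil memv0 => /eqP->; rewrite dotC dot0l.
have [w [wX uw]] := IH u; have [y [yX xy]] := IH x.
pose e := x - y; pose a := dot (u - w) e / dot e e.
have aE : a * dot e e = dot (u - w) e.
  have [e0|e0] := eqVneq (dot e e) 0; last by rewrite divfK.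
  by rewrite /a (dot_eq0 e0) !(dotC (u - w)) !dot0l mul0r mul0r.
have subX z : z \in <<X>>%VS -> z \in <<x :: X>>%VS.
  by rewrite span_cons => zX; rewrite -[z]add0r memv_add ?mem0v.
exists (w + a *: e); split.
  apply: memvD; first exact: subX.
  by apply/memvZ/memvB; [apply: memv_span; exact: mem_head|exact: subX].
move=> z; rewrite /carrier /= span_cons => /memv_addP[_ /vlineP[k ->] [z' z'X ->]].
have -> : k *: x + z' = k *: e + (k *: y + z').
  by rewrite scalerBr addrA subrK.
have kX : k *: y + z' \in <<X>>%VS by rewrite memvD ?memvZ.
rewrite opprD addrA dotDr dotZr !(dotDl (u - w)) !dotNl !dotZl.
by rewrite (uw _ kX) (xy _ kX) -aE; ring.
Qed.

Lemma orthprojP (V : set E) u : (exists H, V = carrier H) ->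
  V (orthproj V u) /\ orthogonal_to (u - orthproj V u) V.
Proof.
move=> [H ->]; have [w [wH uw]] := orthogonal_projection_exists H u.
by apply: (@xgetPex _ 0 [set w | carrier H w /\ _]); exists w.
Qed.

(** [orthproj] defaults to 0, so a nonzero value is a genuine projection even
    onto a set that is not known to be linear. *)
Lemma orthproj_nonzero (V : set E) u : orthproj V u != 0 ->
  V (orthproj V u) /\ orthogonal_to (u - orthproj V u) V.
Proof.
by rewrite /orthproj; case: xgetP => [w _ //|_]; rewrite eqxx.
Qed.

Lemma orthproj_unique H u w : w \in H -> orthogonal_to (u - w) (carrier H) ->
  orthproj (carrier H) u = w.
Proof.
move=> wH uw; have [|pH up] := @orthprojP (carrier H) u; first by exists H.
apply/eqP; rewrite -subr_eq0; apply/eqP/dot_eq0; set p := orthproj _ _ in pH up *.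
have pw : carrier H (p - w) by apply: memvB.
have -> : dot (p - w) (p - w) = dot (u - w) (p - w) - dot (u - p) (p - w).
  by rewrite -dotNl -dotDl; congr dot; rewrite opprB [RHS]addrC addrA subrK.
by rewrite uw // up // subr0.
Qed.

Lemma orthproj_id H u : u \in H -> orthproj (carrier H) u = u.
Proof. by move=> uH; apply: orthproj_unique => // z _; rewrite subrr dot0l. Qed.

Lemma orthproj_mem H u : orthproj (carrier H) u \in H.
Proof. by have [] := @orthprojP (carrier H) u; first by exists H. Qed.

Lemma orthproj_orthogonal H u :
  orthogonal_to (u - orthproj (carrier H) u) (carrier H).
Proof. by have [] := @orthprojP (carrier H) u; first by exists H. Qed.

Lemma orthprojD H u v :
  orthproj (carrier H) (u + v) = orthproj (carrier H) u + orthproj (carrier H) v.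
Proof.
apply: orthproj_unique; first by rewrite memvD ?orthproj_mem.
move=> z zH; rewrite opprD addrACA dotDl.
by rewrite !orthproj_orthogonal ?addr0.
Qed.

Lemma orthprojZ H (a : R) u :
  orthproj (carrier H) (a *: u) = a *: orthproj (carrier H) u.
Proof.
apply: orthproj_unique; first by rewrite memvZ ?orthproj_mem.
by move=> z zH; rewrite -scalerBr dotZl orthproj_orthogonal ?mulr0.
Qed.

Lemma pythagoras u v : dot u v = 0 -> dot (u + v) (u + v) = dot u u + dot v v.
Proof. by move=> uv; rewrite !dotE (dotC v) uv; ring. Qed.

Lemma enorm_orthogonal_part u w (V : set E) :
  V w -> orthogonal_to (u - w) V -> enorm (u - w) <= enorm u.
Proof.
move=> Vw /(_ w Vw) uw; apply: enorm_le.
by have := pythagoras uw; rewrite subrK => ->; rewrite lerDl dot_ge0.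
Qed.

Lemma enorm_orthproj H u : enorm (orthproj (carrier H) u) <= enorm u.
Proof.
have uw := orthproj_orthogonal u (orthproj_mem H u); apply: enorm_le.
by have := pythagoras uw; rewrite subrK => ->; rewrite lerDr dot_ge0.
Qed.

End EuclideanSpace.

(** * Derivatives, approximate tangent spaces and tangent spaces *)

Section Derivatives.
Context {R : realType} {D : nat}.
Local Notation E := 'rV[R]_D.
Implicit Types (u v w x y : E) (H : {vspace E}).

Lemma linear_image_carrier (l : {linear E -> E}) H :
  exists K, [set l v | v in carrier H] = carrier K.
Proof.
exists (linfun l @: H)%VS; apply/seteqP; split => [_ [v vH <-]|w].
  by rewrite /carrier /= -lfunE memv_img.
by move=> /memv_imgP[v vH ->]; exists v => //; rewrite lfunE.
Qed.

Lemma linear_gap_unit (l1 l2 : {linear E -> E}) H (b : R) :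
  (forall e, e \in H -> enorm e = 1 -> enorm (l1 e - l2 e) <= b) ->
  forall v, v \in H -> enorm (l1 v - l2 v) <= b * enorm v.
Proof.
move=> unit_le v vH; have [v0|v0] := eqVneq (enorm v) 0.
  by rewrite (enorm_eq0 v0) (linear0 l1) (linear0 l2) subrr enorm0 mulr0.
pose e : E := (enorm v)^-1 *: v.
have -> : v = enorm v *: e by rewrite scalerA divff ?scale1r.
have e1 : enorm e = 1.
  by rewrite enormZ ger0_norm ?invr_ge0 ?enorm_ge0 // mulVf.
rewrite (linearZZ l1) (linearZZ l2) -scalerBr 2!enormZ e1 mulr1 mulrC.
rewrite (ger0_norm (enorm_ge0 v)).
by rewrite ler_wpM2r ?enorm_ge0 // unit_le // memvZ.
Qed.

(** Serves to move a derivative between functions that agree on H only. *)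
Lemma derive_eq_along (f g : E -> E) a b v w :
  (forall t : R, f (t *: v + a) = g (t *: w + b)) -> 'D_v f a = 'D_w g b.
Proof.
move=> fg; have fab : f a = g b by have := fg 0; rewrite !scale0r !add0r.
suff fgq : (fun t : R => t^-1 *: ((f \o shift a) (t *: v) - f a)) =
           (fun t : R => t^-1 *: ((g \o shift b) (t *: w) - g b)).
  by rewrite /derive fgq.
by apply/funext => t /=; rewrite fg fab.
Qed.

Lemma poly_map_differentiable m (g : E -> E) x : poly_map m g -> differentiable g x.
Proof.
move=> [p [_ gE]].
have -> : g = \sum_(j < D) (fun y => mpoly.meval (fun i => y 0 i) (p j) *: 'e_j).
  apply/funext => y; rewrite fct_sumE gE [LHS]row_sum_delta.
  by apply: eq_bigr => j _; rewrite mxE.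
apply: differentiable_sum => j; apply: differentiableZl.
under eq_fun do rewrite mpoly.mevalE.
elim: (mpoly.msupp _) => [|a s IH].
  by under eq_fun do rewrite big_nil; exact: differentiable_cst.
under eq_fun do rewrite big_cons.
apply: differentiableD => //; apply: differentiableM; first exact: differentiable_cst.
elim: (index_enum _) => [|i r IHr].
  by under eq_fun do rewrite big_nil; exact: differentiable_cst.
under eq_fun do rewrite big_cons.
apply: differentiableM => //; elim: (mpoly.fun_of_multinom a i) => [|n IHn].
  by under eq_fun do rewrite expr0; exact: differentiable_cst.
under eq_fun do rewrite exprS.
by apply: differentiableM => //; exact: differentiable_coord.
Qed.

Lemma near_enorm_lt (gam : R -> E) (e : R) : 0 < e -> {for 0, continuous gam} ->
  \forall t \near (0 : R), enorm (gam t - gam 0) < e.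
Proof.
move=> e0 cg; have s0 : 0 < Num.sqrt D%:R + 1 :> R by rewrite ltr_wpDl ?sqrtr_ge0.
near=> t; have le_t : `|gam 0 - gam t| < e / (Num.sqrt D%:R + 1).
  by near: t; exact: (cvgr_dist_lt _ _ cg _ (divr_gt0 e0 s0)).
rewrite enormBC; apply: (le_lt_trans (enorm_le_sup _)).
move: le_t; rewrite ltr_pdivlMr //; apply: le_lt_trans.
by rewrite mulrC ler_wpM2l ?normr_ge0 // lerDl.
Unshelve. all: by end_near. Qed.

End Derivatives.

Section TangentSpaces.
Context {R : realType} {D : nat}.
Variable P : mmls R D.
Local Notation E := 'rV[R]_D.
Implicit Types (u v w x y : E).

Lemma gstar_differentiable r x : differentiable (gstar P r) x.
Proof.
rewrite /gstar; case: xgetP => [g _ [gpoly _]|_].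
  exact: poly_map_differentiable gpoly.
exact: differentiable_cst.
Qed.

(** Since [gstar] is polynomial, or constant by default, its directional
    derivatives are linear in the direction. *)
Lemma atangent_carrier r : exists K, atangent P r = carrier K.
Proof.
have [K KE] := linear_image_carrier ('d (gstar P r) 0) (Hof P r).
exists K; rewrite -KE /atangent; congr image; apply/funext => v.
by rewrite deriveE //; exact: gstar_differentiable.
Qed.

Section GraphParametrization.
Variables (k : option nat) (rho : R) (A : set E) (p y0 : E) (phi : E -> E).
Hypotheses (rho0 : 0 < rho) (phiP : graph_param P k rho A p y0 phi).
Hypothesis (y0P : manifold_point k (mdim P) A y0).

(* The extension of phi to the whole space, constant along the normals to H(p). *)
Let F y := phi (projH P p y).

Lemma graph_base : phi 0 = y0. Proof. by case: phiP. Qed.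

Lemma graph_ext_differentiable : differentiable F 0.
Proof.
have [p0 _ _] := phiP; apply; first exact: mem0v.
  by rewrite enorm0.
by rewrite p0.
Qed.

Lemma graph_ext0 : F 0 = y0.
Proof. by rewrite /F /projH orthproj_id ?mem0v // graph_base. Qed.

Lemma diff_graph_ext v : 'd F 0 v = 'D_(projH P p v) phi 0.
Proof.
rewrite -deriveE; last exact: graph_ext_differentiable.
by apply: derive_eq_along => t; rewrite !addr0 /F /projH orthprojZ.
Qed.

(** A curve gam in A satisfies gam t = F (gam t - gam 0) near 0; differentiate. *)
Lemma tangent_graph_fixed w : tangent A y0 w -> 'd F 0 w = w.
Proof.
move=> [gam [gam0 gamA dgam]].
have [ph0 phA [e e0 phiA] _] := phiP.
have gamD : differentiable gam 0 by apply/derivable1_diffP; exact: ex_derive.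
have gam1 : 'd gam 0 1 = w by rewrite -deriveE // derive_val.
pose sh t := gam t - gam 0.
have sh0 : sh 0 = 0 by rewrite /sh subrr.
have shD : differentiable sh 0.
  by apply: (@differentiableB _ _ _ gam (cst (gam 0))) => //; exact: differentiable_cst.
have sh1 : 'd sh 0 1 = w.
  rewrite -deriveE // -gam1 -deriveE //.
  by rewrite (@deriveB _ _ _ gam (cst (gam 0))) // ?derive_cst ?subr0 //;
     apply: diff_derivable => //; exact: differentiable_cst.
have FD : differentiable F (sh 0) by rewrite sh0; exact: graph_ext_differentiable.
(* The base point projects to the origin, so only displacements matter. *)
have projE y : projH P p (y - y0) = projH P p (y - qof P p).
  have [_] := phA 0 (mem0v _) ltac:(by rewrite enorm0); rewrite ph0 => y0q.
  have -> : y - qof P p = (y - y0) + (y0 - qof P p) by rewrite addrA subrK.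
  by rewrite /projH in y0q *; rewrite [RHS]orthprojD y0q addr0.
have Fsh : \forall t \near (0 : R), F (sh t) = gam t.
  have := near_enorm_lt e0 (differentiable_continuous gamD).
  apply: filterS2 gamA => t At; rewrite gam0 => te.
  by rewrite /F /sh gam0 projE phiA.
have Dw : 'D_1 (F \o sh) 0 = w.
  by rewrite (@near_eq_derive _ _ _ (F \o sh) gam 0 1 Fsh) derive_val.
move: Dw; rewrite deriveE; last exact: differentiable_comp.
by rewrite (diff_comp shD FD) /= sh1 sh0.
Qed.

Lemma graph_ext_tangent v : tangent A y0 ('d F 0 v).
Proof.
have [_ phA _ _] := phiP; have FD := graph_ext_differentiable.
exists (fun t : R => F (t *: v)); split.
- by rewrite scale0r graph_ext0.
- have cv : {for (0 : R), continuous (fun t : R => t *: v)} by exact: scalel_continuous.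
  have := near_enorm_lt rho0 cv; apply: filterS => t.
  rewrite scale0r subr0 => tv; apply: (phA _ _ _).1; first exact: orthproj_mem.
  exact: le_lt_trans (enorm_orthproj _ _) tv.
- have sD : is_diff (0 : R) (fun t : R => t *: v) (fun t : R => t *: v).
    exact: is_diff_scalel.
  have F0D : differentiable F ((0 : R) *: v) by rewrite scale0r.
  have cD := differentiable_comp (@ex_diff _ _ _ _ _ _ _ sD) F0D.
  split; first exact: diff_derivable cD.
  rewrite (@deriveE _ _ _ (F \o (fun t : R => t *: v)) 0 1 cD).
  rewrite (diff_comp (@ex_diff _ _ _ _ _ _ _ sD) F0D) /=.
  by rewrite (@diff_val _ _ _ _ _ _ _ sD) scale0r scale1r.
Qed.

Lemma tangent_carrier : exists K, tangent A y0 = carrier K.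
Proof.
have [K KE] := linear_image_carrier ('d F 0) fullv; exists K; rewrite -KE.
apply/seteqP; split=> [w Tw|_ [v _ <-]]; last exact: graph_ext_tangent.
by exists w; [exact: memvf|exact: tangent_graph_fixed].
Qed.

Hypothesis H0 : exists2 v, v \in Hof P p & v != 0.
Variable c : R.
Hypothesis phi_close : deriv_close P k rho c A p phi.

Let kap : R := c * Num.sqrt D%:R * fill_dist P ^+ degree P.

Lemma deriv_close_vector v : v \in Hof P p ->
  enorm ('d F 0 v - 'D_v (gstar P p) 0) <= kap * enorm v.
Proof.
move=> vH; have gD : differentiable (gstar P p) 0 by exact: gstar_differentiable.
rewrite (deriveE _ gD); apply: (linear_gap_unit (H := Hof P p)) vH => e eH e1.
apply: le_trans (enorm_le_sup _) _.
rewrite /kap -mulrA mulrCA ler_wpM2l ?sqrtr_ge0 // distrC.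
have := @phi_close 0 e (mem0v _) _ eH e1; rewrite enorm0 graph_base.
move=> /(_ rho0 y0P).
have -> : 'D_e phi 0 = 'd F 0 e by rewrite diff_graph_ext /projH orthproj_id.
by have -> : 'D_e (gstar P p) 0 = 'd (gstar P p) 0 e by exact: deriveE.
Qed.

(** A nonzero vector of H(p) rules out a negative constant. *)
Lemma deriv_close_ge0 : 0 <= kap.
Proof.
have [v vH v0] := H0; have := le_trans (enorm_ge0 _) (deriv_close_vector vH).
rewrite pmulr_lge0 // lt_def enorm_ge0 andbT.
by apply: contraNneq v0 => /enorm_eq0->.
Qed.

(** The true derivative over H maps v = proj_H w to w, and |v| <= |w|. *)
Lemma tangent_gap w : tangent A y0 w ->
  exists u, atangent P p u /\ enorm (w - u) <= kap * enorm w.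
Proof.
move=> Tw; pose v := projH P p w.
have vH : v \in Hof P p by exact: orthproj_mem.
exists ('D_v (gstar P p) 0); split; first by exists v.
have dv : 'd F 0 v = w.
  rewrite -[RHS](tangent_graph_fixed Tw) !diff_graph_ext.
  by rewrite /v /projH (orthproj_id (orthproj_mem _ _)).
rewrite -{1}dv; apply: le_trans (deriv_close_vector vH) _.
by rewrite ler_wpM2l ?deriv_close_ge0 // enorm_orthproj.
Qed.

End GraphParametrization.
End TangentSpaces.

(** * Consequences of the setting, and the arithmetic of one step *)

Section SettingFacts.
Context {R : realType} {D : nat}.
Variables (P : mmls R D) (c1 c2 c3 cqu : R).
Hypothesis PP : mmls_setting P c1 c2 c3 cqu.
Local Notation E := 'rV[R]_D.
Local Notation M := (manifold P).
Implicit Types (u v w x y : E).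

(** A minimum over finitely many pairs of distinct points. *)
Lemma separation_gt0 : 0 < separation P.
Proof.
have [Suniq Ssize _] := set_samples PP.
have pos_lb (L : seq (E * E)) : exists2 e : R, 0 < e &
    forall z, z \in L -> z.1 != z.2 -> e <= enorm (z.1 - z.2).
  elim: L => [|z L [e e0 IH]]; first by exists 1.
  have [z12|z12] := eqVneq z.1 z.2.
    exists e => // z'; rewrite inE => /orP[/eqP->|]; last exact: IH.
    by rewrite z12 eqxx.
  exists (Num.min e (enorm (z.1 - z.2))).
    rewrite lt_min e0 lt_def enorm_ge0 andbT.
    by apply: contraNneq z12 => /enorm_eq0/eqP; rewrite subr_eq0.
  move=> z'; rewrite inE ge_min => /orP[/eqP->|z'L z'12].
    by rewrite lexx orbT.
  by rewrite IH.
have [e e0 le_e] := pos_lb [seq (s, t) | s <- samples P, t <- samples P].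
rewrite mulr_gt0 ?invr_gt0 ?ltr0n //; apply: lt_le_trans e0 _.
apply: lb_le_inf.
  move: Ssize Suniq; case: (samples P) => [|a [|b S]] //= _.
  rewrite inE negb_or => /andP[/andP[ab _] _].
  exists (enorm (a - b)), (a, b) => //=.
  by rewrite !inE !eqxx ab orbT.
move=> _ [[s t] [/= sS tS st] <-]; apply: (le_e (s, t)) => //.
by apply/allpairsP; exists (s, t).
Qed.

Lemma fill_dist_gt0 : 0 < fill_dist P.
Proof.
have [_ /andP[le_sep _]] := set_quasi_uniform PP.
exact: lt_le_trans separation_gt0 le_sep.
Qed.

Lemma graph_radius_gt0 : 0 < c1 * fill_dist P.
Proof.
have [c13 _ _] := set_consts PP.
by rewrite mulr_gt0 ?fill_dist_gt0 // (lt_trans _ c13) ?ltr0n.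
Qed.

Lemma dist_to_self (A : set E) x : A x -> dist_to A x <= 0.
Proof.
move=> Ax; apply: ge_inf.
  by exists 0 => _ [y _ <-]; exact: enorm_ge0.
by exists x => //; rewrite subrr enorm0.
Qed.

(** The first minimization has a solution at p, so that H(p) is not the default
    value and has positive dimension. *)
Lemma Hof_nonzero p : M p -> exists2 v, v \in Hof P p & v != 0.
Proof.
move=> Mp; have [e e0 /(_ p)] := set_unique PP.
have Mpe : tube M e p by exact: le_lt_trans (dist_to_self Mp) e0.
move=> /(_ Mpe)[q [H [qH _]]].
have : step1_min P p (step1_sol P p).1 (step1_sol P p).2.
  by apply: (@xgetPex _ _ [set qH | step1_min P p qH.1 qH.2]); exists (q, H).
move=> [[dimH _ _ _] _]; exists (vpick (Hof P p)); first exact: memv_pick.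
rewrite vpick0 -dimv_eq0 /Hof dimH.
by have := set_dim PP; case: (mdim P).
Qed.

End SettingFacts.

Section DescentArithmetic.
Context {R : realType}.

(** All bounds use beta >= 1/2.  If the radius Q caps the step, Lv <= Q / 8 gives
    the coefficient 1/4 - 3/16 = 1/16; otherwise Lv <= gam / (16 Lt) gives
    1/8 - 3/32 = 1/32, and beta gam < Q Lt. *)
Lemma step_decrease (Q Lt Lv gam NK : R) (beta := 1 - NK / gam)
    (alpha := Num.min (Q / gam) (Lt^-1 * beta))
    (drop := alpha * gam ^+ 2 * beta - 3 / 2 * gam * Lv
             - Lt / 2 * (alpha * gam) ^+ 2) :
  0 < Lt -> 0 < Lv -> 8 * Lv <= Q -> 0 < gam ->
  16 * Lt * Lv <= gam -> 2 * NK <= gam ->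
  (gam <= 2 * Q * Lt /\ gam ^+ 2 / (32 * Lt) <= drop) \/ Q * gam / 16 <= drop.
Proof.
move=> Lt0 Lv0 LvQ gam0 Lvgam NKgam.
have beta2 : 2^-1 <= beta.
  have : NK / gam <= 2^-1 by rewrite ler_pdivrMr //; lra.
  by rewrite /beta; lra.
rewrite /drop /alpha {drop alpha}; move: beta beta2 => {}beta beta2.
have [Qb|bQ] := leP (Q / gam) (Lt^-1 * beta).
  right; rewrite divfK ?gt_eqF // expr2 mulrA divfK ?gt_eqF //.
  have QLt : Q * Lt <= beta * gam.
    by move: Qb; rewrite ler_pdivlMl // mulrA ler_pdivrMr // mulrC.
  have Q0 : 0 < Q by lra.
  have : Q * (Q * Lt) <= Q * (beta * gam) by rewrite ler_wpM2l // ltW.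
  have : gam * (8 * Lv) <= gam * Q by rewrite ler_wpM2l // ltW.
  have : (Q * gam) * 2^-1 <= (Q * gam) * beta by rewrite ler_wpM2l // mulr_ge0 // ltW.
  lra.
left; split.
  have : beta * gam < Q * Lt.
    by move: bQ; rewrite ltr_pdivrMl // mulrA ltr_pdivlMr // [Lt * _]mulrC.
  nra.
have -> : Lt^-1 * beta * gam ^+ 2 * beta = beta ^+ 2 * gam ^+ 2 / Lt by field; lra.
have -> : Lt / 2 * (Lt^-1 * beta * gam) ^+ 2 = beta ^+ 2 * gam ^+ 2 / Lt / 2.
  by field; lra.
have -> : gam ^+ 2 / (32 * Lt) = gam ^+ 2 / Lt / 32 by field; lra.
have : gam * Lv <= gam ^+ 2 / Lt / 16.
  by rewrite !ler_pdivlMr //; nra.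
have : 4^-1 * (gam ^+ 2 / Lt) <= beta ^+ 2 * gam ^+ 2 / Lt.
  rewrite -mulrA; apply: ler_wpM2r; last by nra.
  by rewrite divr_ge0 ?sqr_ge0 ?ltW.
lra.
Qed.

Lemma taylor_decrease (fx fy s q a gam NK n Lv : R) :
  0 < gam -> 0 <= NK -> 2 * NK <= gam -> 0 < Lv -> n <= Lv ->
  fy <= fx + s + q ->
  s <= - (a * gam ^+ 2) + gam * n + NK * (a * gam + n) ->
  fy <= fx - (a * gam ^+ 2 * (1 - NK / gam) - 3 / 2 * gam * Lv - q).
Proof.
move=> gam0 NK0 NKgam Lv0 nLv fyle sle.
have -> : a * gam ^+ 2 * (1 - NK / gam) = a * gam ^+ 2 - NK * (a * gam).
  by field; rewrite gt_eqF.
have : gam * n <= gam * Lv by apply: ler_wpM2l; [exact: ltW|].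
have : NK * n <= NK * Lv by exact: ler_wpM2l.
have : 2 * NK * Lv <= gam * Lv by apply: ler_wpM2r; [exact: ltW|].
lra.
Qed.

End DescentArithmetic.

(** * One sample set: descent, gradient bounds and complexity *)

Section OneSampleSet.
Context {R : realType} {D : nat}.
Variables (P : mmls R D) (c1 c2 c3 cqu cMMLS cM cMt L Lt Lv G : R).
Variables (f : 'rV[R]_D -> R) (phi phit : 'rV[R]_D -> 'rV[R]_D -> 'rV[R]_D).
Variables (v : 'rV[R]_D -> 'rV[R]_D -> R -> 'rV[R]_D) (Qr : 'rV[R]_D -> R).
Local Notation E := 'rV[R]_D.
Local Notation M := (manifold P).
Local Notation h := (fill_dist P).
Local Notation m := (degree P).
Let Q := retr_radius P Qr.
Hypothesis settingP : mmls_setting P c1 c2 c3 cqu.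
Hypothesis factsP : small_fill_facts P.
Hypothesis approxP : mmls_approximation P c1 cMMLS cM cMt phi phit.
Hypothesis f_lip : grad_lipschitz_on (conv_hull (Mt P `|` M)) f L.
Hypothesis hL : h * L <= 1.
Hypothesis f_bound : forall r, Mt P r -> enorm (egrad f r) <= G.
Hypothesis domP : aretr_domain P Qr.
Hypothesis regP : aretr_regular P Q Lv Lt f v.
Implicit Types (u w x y p : E).

(** p and its image share the subspace H and the polynomial on H. *)
Lemma atangent_proj p : M p -> atangent P (proj_mmls P p) = atangent P p.
Proof.
move=> Mp; rewrite /atangent (fact_H factsP Mp); apply/seteqP.
have gE w : w \in Hof P p ->
    'D_w (gstar P (proj_mmls P p)) 0 = 'D_w (gstar P p) 0.
  move=> wH; apply: derive_eq_along => t.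
  by rewrite addr0 (fact_g factsP Mp) ?memvZ.
split=> _ [w wH <-]; exists w; [exact: wH| |exact: wH|exact: gE].
by symmetry; exact: gE.
Qed.

Lemma agradP x : atangent P x (agrad P f x) /\
  orthogonal_to (egrad f x - agrad P f x) (atangent P x).
Proof. exact/orthprojP/atangent_carrier. Qed.

Section AtManifoldPoint.
Variable p : E.
Hypothesis Mp : M p.

Lemma tangent_gap_M w : tangent M p w ->
  exists u, atangent P (proj_mmls P p) u /\
    enorm (w - u) <= cM * Num.sqrt D%:R * h ^+ m * enorm w.
Proof.
rewrite atangent_proj //; apply: (tangent_gap (graph_radius_gt0 settingP)).
- exact: approx_phi approxP _ Mp.
- by have [_ _] := set_manifold settingP; apply.
- exact: Hof_nonzero settingP _ Mp.
- exact: approx_M approxP _ Mp.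
Qed.

Lemma cM_ge0 : 0 <= cM * Num.sqrt D%:R * h ^+ m.
Proof.
apply: (deriv_close_ge0 (graph_radius_gt0 settingP)).
- exact: approx_phi approxP _ Mp.
- by have [_ _] := set_manifold settingP; apply.
- exact: Hof_nonzero settingP _ Mp.
- exact: approx_M approxP _ Mp.
Qed.

Hypothesis Sx : Mt_smooth P (proj_mmls P p).

Lemma tangent_gap_Mt w : tangent (Mt P) (proj_mmls P p) w ->
  exists u, atangent P (proj_mmls P p) u /\ enorm (w - u) <= kappa P cMt * enorm w.
Proof.
rewrite atangent_proj //; apply: (tangent_gap (graph_radius_gt0 settingP)).
- exact: approx_phit approxP _ Mp.
- exact: Sx.
- exact: Hof_nonzero settingP _ Mp.
- exact: approx_Mt approxP _ Mp.
Qed.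

Lemma kappa_ge0 : 0 <= kappa P cMt.
Proof.
apply: (deriv_close_ge0 (graph_radius_gt0 settingP)).
- exact: approx_phit approxP _ Mp.
- exact: Sx.
- exact: Hof_nonzero settingP _ Mp.
- exact: approx_Mt approxP _ Mp.
Qed.

Lemma rgrad_dot w : tangent (Mt P) (proj_mmls P p) w ->
  dot (rgrad f (Mt P) (proj_mmls P p)) w = dot (egrad f (proj_mmls P p)) w.
Proof.
move=> Tw; have [|_ gP] := @orthprojP _ _ (tangent (Mt P) (proj_mmls P p))
    (egrad f (proj_mmls P p)).
  by apply: (tangent_carrier (graph_radius_gt0 settingP) (approx_phit approxP Mp)).
by apply/eqP; rewrite eq_sym -subr_eq0 -dotNl -dotDl; apply/eqP/gP.
Qed.

End AtManifoldPoint.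

(** The component of Gr off V pairs with w = xi + v' only through w - u, for any
    u in V. *)
Lemma tilted_dot (V : set E) (Gr g xi v' u : E) (kap : R) :
  V g -> orthogonal_to (Gr - g) V -> V xi -> V u -> 0 <= kap ->
  enorm (xi + v' - u) <= kap * enorm (xi + v') ->
  dot Gr (xi + v') <=
    dot g xi + enorm g * enorm v' + enorm Gr * kap * (enorm xi + enorm v').
Proof.
move=> Vg gP Vxi Vu kap0 gap; set w := xi + v'.
have -> : dot Gr w = dot g xi + dot g v' + dot (Gr - g) (w - u).
  have -> : dot Gr w = dot g w + dot (Gr - g) w by rewrite -dotDl addrC subrK.
  by rewrite [dot _ (w - u)]dotDr dotNr (gP u Vu) oppr0 addr0 /w [dot g (_ + _)]dotDr.
rewrite lerD // ?lerD2l ?dot_le_enormM //.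
apply: le_trans (dot_le_enormM _ _) _; rewrite -mulrA.
apply: ler_pM; rewrite ?enorm_ge0 //; first exact: enorm_orthogonal_part Vg gP.
by apply: (le_trans gap); rewrite ler_wpM2l // enormD.
Qed.

(** The two branches of the step size: uncapped, then capped by the radius Q. *)
Definition sufficient_decrease x :=
  (enorm (agrad P f x) <= 2 * Q * Lt /\
   f (next_iterate P f cMt Q Lt x) <= f x - enorm (agrad P f x) ^+ 2 / (32 * Lt)) \/
  f (next_iterate P f cMt Q Lt x) <= f x - Q * enorm (agrad P f x) / 16.

Lemma iterate_step x : 8 * Lv <= Q -> Mt P x -> Mt_smooth P x ->
  0 < step_alpha P f cMt Q Lt x ->
  noise_level P f cMt Lt Lv x <= enorm (agrad P f x) ->
  Mt P (next_iterate P f cMt Q Lt x) /\ sufficient_decrease x.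
Proof.
move=> LvQ [p Mp <-] {x}; set x := proj_mmls P p => Sx alpha0.
have Mtx : Mt P x by exists p.
rewrite ge_max => /andP[Lvg kapg].
have Lv0 := reg_Lv regP; have Lt0 := reg_Lt regP.
rewrite /sufficient_decrease /next_iterate; set g := agrad P f x in Lvg kapg *.
set a := step_alpha P f cMt Q Lt x in alpha0 *; set gam := enorm g in Lvg kapg *.
have gam0 : 0 < gam by apply: lt_le_trans Lvg; rewrite !mulr_gt0.
have [gT gP] := agradP x; rewrite -/g in gT gP.
pose xi := a *: - g; rewrite -/xi.
have xiT : atangent P x xi.
  have [K KE] := atangent_carrier P x; rewrite KE in gT *.
  by apply: memvZ; rewrite memvN.
have xiE : enorm xi = a * gam by rewrite enormZ enormN gtr0_norm.
have xiQ : enorm xi <= Q.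
  by rewrite xiE -ler_pdivlMr // /a /step_alpha /alpha_of ge_min lexx.
have Kx : Kset P Q (x, xi) by [].
have [Qpos Qdom] := (domP.1 x Mtx).
have QQr : Q <= Qr x.
  apply: ge_inf; last by exists x.
  by exists 0 => _ [r /(domP.1 r)[/ltW r0 _] <-].
split.
  apply: (fact_range factsP); exists (x + xi) => //.
  by apply: Qdom => //; exact: le_trans QQr.
set v' := derive1 (v x xi) 0.
have vL : enorm v' <= Lv := reg_v_bound regP Kx Sx.
have [_ Tw] := reg_deriv regP Kx Sx; rewrite -/v' in Tw.
have taylor := reg_taylor regP Kx Sx.
rewrite -/v' (rgrad_dot Mp Sx Tw) -/x xiE in taylor.
have [u [uT gap]] := tangent_gap_Mt Mp Sx Tw.
have kap0 := kappa_ge0 Mp Sx.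
have := tilted_dot gT gP xiT uT kap0 gap; rewrite xiE -/gam.
have -> : dot g xi = - (a * gam ^+ 2) by rewrite dotZr dotNr enorm_sqr mulrN.
set N := enorm (egrad f x) in kapg *; set kap := kappa P cMt in kap0 *.
have N0 : 0 <= N by exact: enorm_ge0.
have {}kapg : 2 * (N * kap) <= gam.
  apply: le_trans kapg; rewrite le_eqVlt; apply/orP; left.
  by apply/eqP; rewrite /kap /kappa; ring.
move=> dle; have {}taylor : f (aretr P x xi) <=
    f x + dot (egrad f x) (xi + v') + Lt / 2 * (a * gam) ^+ 2.
  by move: taylor; rewrite ler_distl => /andP[].
pose drop := a * gam ^+ 2 * (1 - N * kap / gam) - 3 / 2 * gam * Lv
             - Lt / 2 * (a * gam) ^+ 2.
have dropE : f (aretr P x xi) <= f x - drop.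
  apply: (taylor_decrease gam0 _ kapg Lv0 vL taylor) => //.
  by rewrite mulr_ge0.
have [[gamQ dropL]|dropQ] := step_decrease Lt0 Lv0 LvQ gam0 Lvg kapg.
  by left; split => //; apply: le_trans dropE _; rewrite lerD2l lerN2.
by right; apply: le_trans dropE _; rewrite lerD2l lerN2.
Qed.


(** Test against w = grad_M f (p) itself: |w|^2 = <grad f (p), w>, then pass from
    p to x by the Lipschitz bound and split grad f (x) along the approximate
    tangent space. *)
Lemma enorm_rgrad_M p : M p ->
  enorm (rgrad f M p) <= (cM * G + cMMLS) * Num.sqrt D%:R * h ^+ m
    + enorm (agrad P f (proj_mmls P p)).
Proof.
move=> Mp; set x := proj_mmls P p; set w := rgrad f M p.
have Mtx : Mt P x by exists p.
have h0 := fill_dist_gt0 settingP.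
have kap0 := cM_ge0 Mp; set kap := cM * _ * _ in kap0.
have proj0 : 0 <= cMMLS * Num.sqrt D%:R * h ^+ m.
  have := le_trans (enorm_ge0 _) (approx_proj approxP Mp).
  by rewrite exprSr mulrA pmulr_lge0.
set C := cMMLS * _ * _ in proj0.
have NG := f_bound Mtx; have N0 := enorm_ge0 (egrad f x).
have -> : (cM * G + cMMLS) * Num.sqrt D%:R * h ^+ m = G * kap + C.
  by rewrite /kap /C; ring.
have [w0|w0] := eqVneq w 0.
  by rewrite w0 enorm0 !addr_ge0 ?enorm_ge0 // mulr_ge0 // (le_trans N0).
have [Tw wP] := orthproj_nonzero w0.
have [gT gP] := agradP x; have [K KE] := atangent_carrier P x.
have [u [uT gap]] := tangent_gap_M Mp Tw.
have V0 : atangent P x 0 by rewrite KE; exact: mem0v.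
have := @tilted_dot (atangent P x) (egrad f x) (agrad P f x) 0 w u kap gT gP V0 uT kap0.
rewrite add0r [dot _ 0]dotC dot0l enorm0 !add0r => /(_ gap) dle.
have lip : enorm (egrad f p - egrad f x) <= C.
  have hullP y : (Mt P `|` M) y -> conv_hull (Mt P `|` M) y.
    by move=> Ay B [_ AB]; exact: AB.
  have [_ fL] := f_lip.
  apply: le_trans (fL _ _ (hullP _ (or_introl Mtx)) (hullP _ (or_intror Mp))) _.
  rewrite enormBC; have [L0|/ltW L0] := leP L 0.
    by apply: le_trans proj0; rewrite mulr_le0_ge0 ?enorm_ge0.
  apply: le_trans (ler_wpM2l L0 (approx_proj approxP Mp)) _.
  rewrite exprSr !mulrA -[leRHS]mulr1 -/C.
  have -> : L * cMMLS * Num.sqrt D%:R * h ^+ m * h = C * (h * L) by rewrite /C; ring.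
  exact: ler_wpM2l.
have w_gt0 : 0 < enorm w.
  by rewrite lt_def enorm_ge0 andbT; apply: contraNneq w0 => /enorm_eq0->.
rewrite -(ler_pM2r w_gt0).
have -> : enorm w * enorm w = dot (egrad f x) w + dot (egrad f p - egrad f x) w.
  rewrite -dotDl addrC subrK -expr2 enorm_sqr.
  by apply/eqP; rewrite eq_sym -subr_eq0 -dotNl -dotDl; apply/eqP/wP.
have : dot (egrad f p - egrad f x) w <= C * enorm w.
  by apply: le_trans (dot_le_enormM _ _) _; rewrite ler_wpM2r ?enorm_ge0.
have : enorm (egrad f x) * kap * enorm w <= G * kap * enorm w.
  by rewrite ler_wpM2r ?enorm_ge0 // ler_wpM2r.
move: dle; rewrite mulrDl mulrDl.
set A := dot (egrad f x) w; set B := dot (_ - _) w.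
set F := enorm (egrad f x) * kap * _.
set a := enorm (agrad P f x) * _; set b := G * kap * _; set c := C * _.
by move=> aF Fb Bc; lra.
Qed.

Section Runs.
Variables (fstar eps : R) (x0 : E).
Hypothesis fstarP : forall y, (M `|` Mt P) y -> fstar <= f y.
Hypothesis LvQ : 8 * Lv <= Q.
Hypothesis Mtx0 : Mt P x0.
Hypothesis eps0 : 0 < eps.

Local Notation run := (mmls_run P f cMt Q Lt Lv eps x0).
Local Notation returned := (mmls_returned P f cMt Lt Lv cM cMMLS G eps).
Local Notation small := (bound_a P f cMt Lt Lv eps).

Lemma small_returned (x : nat -> E) k :
  x 0%N = x0 -> (forall j, (j < k)%N -> ~ small (x j)) ->
  small (x k) -> Mt P (x k) -> f (x k) <= f x0 -> returned x k.
Proof.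
move=> xx0 first_k sk Mtk fk; split => //; first by rewrite xx0.
move=> p Mp px; rewrite -px in sk Mtk *; split; last 2 first.
- exact: f_bound.
- rewrite enormBC.
  exact: (approx_proj approxP Mp).
by apply: le_trans (enorm_rgrad_M Mp) _; rewrite lerD2l.
Qed.

Section Decrease.
Variables (T : nat) (x : nat -> E) (dl : R).
Hypotheses (runx : run T x) (dl0 : 0 < dl).
Hypothesis decrease : forall j, (j < T)%N ->
  mmls_performed P f cMt Lt Lv eps x j -> sufficient_decrease (x j) ->
  f (next_iterate P f cMt Q Lt (x j)) < f (x j) - dl.

Lemma run_descends n : (n <= T)%N -> (forall j, (j < n)%N -> ~ small (x j)) ->
  Mt P (x n) /\ if n is 0%N then f (x n) = f x0 else f (x n) < f x0 - n%:R * dl.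
Proof.
elim: n => [|n IH] nT not_small; first by rewrite runx.1.
have [Mtn fn] := IH (ltnW nT) (fun j jn => not_small j (ltnW jn)).
have [Sn _ an noise xn] := runx.2 n nT not_small.
have [Mtn1 dec] := iterate_step LvQ Mtn Sn an noise.
split; rewrite xn //; have := decrease nT not_small dec.
by case: (n) fn => [->|k fk lt_f]; rewrite ?mul1r // (natrD _ 1 k.+1); lra.
Qed.

Let bound := Num.ceil ((f x0 - fstar) / dl).

Lemma gap_ge0 : 0 <= f x0 - fstar.
Proof. by rewrite subr_ge0; apply: fstarP; right. Qed.

(** Otherwise max(bound, 1) steps, each lowering f by more than dl, would bring f
    strictly below fstar. *)
Lemma returned_in_time : (0 < T)%N -> bound <= T%:Z ->
  exists2 k : nat, k%:Z <= bound & returned x k.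
Proof.
move=> T0 boundT; have bound0 : 0 <= bound.
  by rewrite -(ceil0 R) le_ceil // divr_ge0 ?gap_ge0 // ltW.
have [K boundE] : exists K : nat, bound = K%:Z.
  by exists `|bound|%N; rewrite gez0_abs.
rewrite boundE in boundT *; have {boundT}KT : (K <= T)%N by [].
have gapK : f x0 - fstar <= K%:R * dl.
  by rewrite -ler_pdivrMr // -[K%:R]/(K%:Z%:~R) -boundE ceil_ge.
have [[k0 [k0K sk0]]|none] := pselect (exists k, (k <= K)%N /\ small (x k)).
  have ex_small : exists k, `[< small (x k) >] by exists k0; exact/asboolP.
  have [k /asboolP sk kmin] := ex_minnP ex_small.
  have kK : (k <= K)%N by apply: leq_trans (kmin _ _) k0K; exact/asboolP.
  have first_k j : (j < k)%N -> ~ small (x j).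
    by move=> jk sj; move: jk; rewrite ltnNge kmin //; exact/asboolP.
  exists k => //; have [Mtk fk] := run_descends (leq_trans kK KT) first_k.
  apply: small_returned => //; first exact: runx.1.
  case: (k) fk => [->//|k' /ltW fk]; apply: le_trans fk _.
  by rewrite gerBl mulr_ge0 // ltW.
(* Even when the bound is 0 one iteration is needed for a strict decrease. *)
exfalso; have [|j|Mtn] := @run_descends (maxn K 1); first by rewrite geq_max KT.
  move=> jn sj; apply: none; exists j; split => //.
  by move: jn; rewrite leq_max => /orP[/ltnW //|]; case: (j).
move=> fn; have {}fn : f (x (maxn K 1)) < f x0 - (maxn K 1)%:R * dl.
  by move: fn (leq_maxr K 1); case: (maxn K 1).
have : f (x (maxn K 1)) < fstar.
  apply: lt_le_trans fn _; rewrite lerBlDl -lerBlDr; apply: le_trans gapK _.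
  by apply: ler_wpM2r; [exact: ltW|rewrite ler_nat leq_maxl].
by rewrite ltNge fstarP //; right.
Qed.

End Decrease.

Lemma performed_gt (x : nat -> E) j :
  mmls_performed P f cMt Lt Lv eps x j ->
  eps3 P f cMt Lt Lv eps (x j) < enorm (agrad P f (x j)).
Proof. by move=> /(_ j (leqnn j))/negP; rewrite -ltNge. Qed.

(** In this range the uncapped step is excluded, since it needs gam <= 2 Q Lt. *)
Lemma decrease_large_eps3 T (x : nat -> E) (e : R) : 0 < e ->
  (forall j, (j < T)%N -> mmls_performed P f cMt Lt Lv eps x j ->
     e <= eps3 P f cMt Lt Lv eps (x j)) ->
  2 * Q * Lt < e ->
  forall j, (j < T)%N -> mmls_performed P f cMt Lt Lv eps x j ->
  sufficient_decrease (x j) ->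
  f (next_iterate P f cMt Q Lt (x j)) < f (x j) - Q * e / 16.
Proof.
move=> e0 e_le eQ j jT perf; have Q0 := domP.2.
have := performed_gt perf; have := e_le _ jT perf.
rewrite /sufficient_decrease; move: (enorm _) => gam ee eg.
have {ee} eg : e < gam by exact: le_lt_trans eg.
case=> [[gQ _]|dec]; first by lra.
by apply: le_lt_trans dec _; rewrite ltrD2l ltrN2 ltr_pM2r ?invr_gt0 // ltr_pM2l.
Qed.

(** Here Q e / 16 >= e^2 / (32 Lt), so that both branches are good enough. *)
Lemma decrease_small_eps3 T (x : nat -> E) (e : R) : 0 < e ->
  (forall j, (j < T)%N -> mmls_performed P f cMt Lt Lv eps x j ->
     e <= eps3 P f cMt Lt Lv eps (x j)) ->
  e <= 2 * Q * Lt ->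
  forall j, (j < T)%N -> mmls_performed P f cMt Lt Lv eps x j ->
  sufficient_decrease (x j) ->
  f (next_iterate P f cMt Q Lt (x j)) < f (x j) - e ^+ 2 / (32 * Lt).
Proof.
move=> e0 e_le eQ j jT perf; have Q0 : 0 < Q := domP.2; have Lt0 := reg_Lt regP.
have := performed_gt perf; have := e_le _ jT perf.
rewrite /sufficient_decrease; move: (enorm _) => gam ee eg.
have {ee} eg : e < gam by exact: le_lt_trans eg.
have Lt32 : 0 < 32 * Lt by rewrite mulr_gt0.
case=> [[_ dec]|dec]; apply: le_lt_trans dec _; rewrite ltrD2l ltrN2.
  by rewrite ltr_pM2r ?invr_gt0 // ltrXn2r // ?nnegrE ltW // (lt_trans e0).
rewrite ltr_pdivrMr //.
have -> : Q * gam / 16 * (32 * Lt) = gam * (2 * Q * Lt) by field.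
rewrite expr2; apply: lt_le_trans (_ : e * gam <= _); first by rewrite ltr_pM2l.
by rewrite mulrC ler_pM2l // (lt_trans e0).
Qed.

(** eps itself is a lower bound of eps3, uniform in the run. *)
Lemma uniform_returned : exists N : nat, forall (T : nat) (x : nat -> E),
  (N <= T)%N -> run T x -> exists2 k, (k <= T)%N & returned x k.
Proof.
have Q0 : 0 < Q := domP.2; have Lt0 := reg_Lt regP; have Lv0 := reg_Lv regP.
have Lt32 : 0 < 32 * Lt by rewrite mulr_gt0.
have eps_le T (x : nat -> E) j : (j < T)%N ->
    mmls_performed P f cMt Lt Lv eps x j -> eps <= eps3 P f cMt Lt Lv eps (x j).
  by move=> _ _; rewrite /eps3 lerDr le_max; apply/orP; left; rewrite ltW ?mulr_gt0.
pose dl := if 2 * Q * Lt < eps then Q * eps / 16 else eps ^+ 2 / (32 * Lt).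
have dl0 : 0 < dl.
  by rewrite /dl; case: ifP => _; rewrite !mulr_gt0 ?invr_gt0 ?exprn_gt0.
exists `|Num.ceil ((f x0 - fstar) / dl)|.+1 => T x NT runx.
have T0 : (0 < T)%N by exact: leq_trans NT.
have boundT : Num.ceil ((f x0 - fstar) / dl) <= T%:Z.
  by apply: le_trans (lez_abs _) _; rewrite lez_nat ltnW.
have [|k kb ret] := returned_in_time runx dl0 _ T0 boundT.
  rewrite /dl; case: ltP => eQ; first exact: decrease_large_eps3 (@eps_le T x) eQ.
  exact: decrease_small_eps3 (@eps_le T x) eQ.
by exists k => //; rewrite -lez_nat (le_trans kb).
Qed.

End Runs.

End OneSampleSet.

(** * Vanishing fill distance *)

Section VanishingFillDistance.
Context {R : realType} {I : Type}.
Variable h : I -> R.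
Hypothesis h_gt0 : forall i, 0 < h i.

Lemma to0_filter : Filter (to0 h).
Proof.
apply: filter_from_filter; first by exists 1; exact: ltr01.
move=> a b a0 b0; exists (Num.min a b); first by rewrite /= lt_min a0 b0.
by move=> i /=; rewrite lt_min => /andP[].
Qed.

Local Instance to0_filter_instance : Filter (to0 h) := to0_filter.

Lemma cvg_to0 : h i @[i --> to0 h] --> 0.
Proof.
apply/cvgrPdist_lt => e e0; exists e => // i /= hi.
by rewrite sub0r normrN gtr0_norm.
Qed.

(** The exponent is known to be positive only from a member of the family; an
    empty family makes every limit trivial. *)
Lemma cvg_to0_pow (k : nat) : (forall i : I, (1 <= k)%N) ->
  h i ^+ k @[i --> to0 h] --> 0.
Proof.
case: k => [k0|k _].
  by apply/cvgrPdist_lt => e e0; exists 1 => [|i]; [exact: ltr01|have := k0 i].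
have <- : (0 : R) ^+ k.+1 = 0 by rewrite expr0n.
apply: (@cvg_comp _ _ _ h (fun y => y ^+ k.+1)) cvg_to0 _.
exact: exprn_continuous.
Qed.

Lemma squeeze_norm (u b : I -> R) : (forall i, `|u i| <= b i) ->
  b i @[i --> to0 h] --> 0 -> u i @[i --> to0 h] --> 0.
Proof.
move=> ub b0; apply/cvgrPdist_lt => e e0.
near=> i; have : `|0 - b i| < e by near: i; exact: (cvgr_dist_lt _ _ b0 _ e0).
rewrite !sub0r !normrN; apply: le_lt_trans.
exact: le_trans (ub i) (ler_norm _).
Unshelve. all: by end_near. Qed.

End VanishingFillDistance.

Theorem theorem26 (R : realType) (D d m : nat) (M : set 'rV[R]_D)
    (I : Type) (S : I -> seq 'rV[R]_D) (th1 : I -> R -> \bar R) (Ph : R -> \bar R)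
    (c1 c2 c3 cqu cMMLS cM cMt L Lt G : R) (Lv : I -> R)
    (f : 'rV[R]_D -> R)
    (phi phit : I -> 'rV[R]_D -> 'rV[R]_D -> 'rV[R]_D)
    (v : I -> 'rV[R]_D -> 'rV[R]_D -> R -> 'rV[R]_D)
    (Qr : I -> 'rV[R]_D -> R) :
  let P i := MMLS M d m (S i) (th1 i) Ph in
  let h i := fill_dist (P i) in
  let Q i := retr_radius (P i) (Qr i) in
  (forall i, mmls_setting (P i) c1 c2 c3 cqu) ->
  (forall i, h i * L <= 1) ->
  (forall i, small_fill_facts (P i)) ->
  (forall i, mmls_approximation (P i) c1 cMMLS cM cMt (phi i) (phit i)) ->
  (forall i, grad_lipschitz_on (conv_hull (Mt (P i) `|` M)) f L) ->
  (forall i r, Mt (P i) r -> enorm (egrad f r) <= G) ->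
  (forall i, aretr_domain (P i) (Qr i)) ->
  (forall i, aretr_regular (P i) (Q i) (Lv i) Lt f (v i)) ->
  Lv i @[i --> to0 h] --> 0 ->
  (forall (i : I) (fstar : R) (x0 : 'rV[R]_D),
     (forall y, (M `|` Mt (P i)) y -> fstar <= f y) ->
     8 * Lv i <= Q i ->
     Mt (P i) x0 ->
     forall eps : R, 0 < eps ->
     let run := mmls_run (P i) f cMt (Q i) Lt (Lv i) eps x0 in
     let returned := mmls_returned (P i) f cMt Lt (Lv i) cM cMMLS G eps in
     let eps3 := eps3 (P i) f cMt Lt (Lv i) eps in
     (exists N : nat, forall (T : nat) (x : nat -> 'rV[R]_D),
        (N <= T)%N -> run T x -> exists2 k, (k <= T)%N & returned x k) /\
     (forall (T : nat) (x : nat -> 'rV[R]_D) (e : R),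
        (0 < T)%N -> run T x -> 0 < e ->
        (forall j, (j < T)%N -> mmls_performed (P i) f cMt Lt (Lv i) eps x j -> e <= eps3 (x j)) ->
        (2 * Q i * Lt < e ->
         Num.ceil (16 * (f x0 - fstar) / Q i * e^-1) <= T%:Z ->
         exists2 k : nat, k%:Z <= Num.ceil (16 * (f x0 - fstar) / Q i * e^-1) & returned x k) /\
        (e <= 2 * Q i * Lt ->
         Num.ceil (32 * (f x0 - fstar) * Lt * (e ^+ 2)^-1) <= T%:Z ->
         exists2 k : nat, k%:Z <= Num.ceil (32 * (f x0 - fstar) * Lt * (e ^+ 2)^-1) & returned x k)) /\
     (forall z : 'rV[R]_D,
        run_prog f (fun y => (egrad f y, agrad (P i) f y)) (aretr (P i))
          (iteration_prog (Q i) Lt (kappa (P i) cMt) z)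
        = ((next_iterate (P i) f cMt (Q i) Lt z, f (next_iterate (P i) f cMt (Q i) Lt z)), (1, 1, 1)%N))) /\
  (forall (eps : R) (x : I -> 'rV[R]_D), 0 < eps -> (forall i, Mt (P i) (x i)) ->
     [/\ bound_b_rhs (P i) f cMt Lt (Lv i) cM cMMLS G eps (x i) @[i --> to0 h] --> eps,
         8 * Lv i @[i --> to0 h] --> 0 &
         noise_level (P i) f cMt Lt (Lv i) (x i) @[i --> to0 h] --> 0]).
Proof.
move=> P h Q settingP hL factsP approxP f_lip f_bound domP regP Lv_to0; split.
  move=> i fstar x0 fstarP LvQ Mtx0 eps eps0 run returned eps3'; split; last split.
  - exact: (uniform_returned (settingP i) (factsP i) (approxP i) (f_lip i) (hL i)
              (f_bound i) (domP i) (regP i) fstarP LvQ Mtx0 eps0).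
  - move=> T x e T0 runx e0 e_le.
    have Q0 : 0 < Q i := (domP i).2; have Lt0 := reg_Lt (regP i).
    split=> eQ.
      have -> : 16 * (f x0 - fstar) / Q i * e^-1 = (f x0 - fstar) / (Q i * e / 16).
        by field; rewrite !gt_eqF.
      apply: (returned_in_time (settingP i) (factsP i) (approxP i) (f_lip i) (hL i)
                (f_bound i) (domP i) (regP i) fstarP LvQ Mtx0 runx) => //.
        by rewrite !mulr_gt0.
      exact: (decrease_large_eps3 (domP i) e0 e_le eQ).
    have -> : 32 * (f x0 - fstar) * Lt * (e ^+ 2)^-1 = (f x0 - fstar) / (e ^+ 2 / (32 * Lt)).
      by field; rewrite !gt_eqF.
    apply: (returned_in_time (settingP i) (factsP i) (approxP i) (f_lip i) (hL i)
              (f_bound i) (domP i) (regP i) fstarP LvQ Mtx0 runx) => //.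
      by rewrite divr_gt0 ?exprn_gt0 // mulr_gt0.
    exact: (decrease_small_eps3 (domP i) (regP i) e0 e_le eQ).
  - by [].
move=> eps x eps0 Mtx.
have h0 i : 0 < h i := fill_dist_gt0 (settingP i).
have FF : Filter (to0 h) := to0_filter h.
have hm_to0 : h i ^+ m @[i --> to0 h] --> 0.
  by apply: cvg_to0_pow => // i; exact: set_degree (settingP i).
have Lv8 : 8 * Lv i @[i --> to0 h] --> 0.
  by rewrite -(mulr0 8); apply: cvgMr.
have noise_to0 : noise_level (P i) f cMt Lt (Lv i) (x i) @[i --> to0 h] --> 0.
  pose c := 2 * `|cMt| * G * Num.sqrt D%:R.
  apply: (@squeeze_norm _ _ h _ (fun i => `|16 * Lt * Lv i| + c * h i ^+ m)).
    move=> i; have NG := f_bound i _ (Mtx i).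
    have N0 := enorm_ge0 (egrad f (x i)).
    have hm0 : 0 <= h i ^+ m by rewrite exprn_ge0 ?ltW.
    have max_norm (a b : R) : `|Num.max a b| <= `|a| + `|b|.
      by case: (leP a b) => _; rewrite ?lerDl ?lerDr normr_ge0.
    apply: le_trans (max_norm _ _) _; rewrite lerD2l !normrM normr_nat.
    rewrite (ger0_norm N0) (ger0_norm (sqrtr_ge0 _)) (ger0_norm hm0).
    by rewrite !ler_wpM2r ?sqrtr_ge0 // ler_wpM2l // mulr_ge0.
  rewrite -[X in _ --> X](addr0 0); apply: cvgD.
    rewrite -[X in _ --> X](normr0 R); apply: cvg_norm.
    by rewrite -(mulr0 (16 * Lt)); apply: cvgMr.
  by rewrite -(mulr0 c); apply: cvgMr.
split => //; rewrite -[X in _ --> X](add0r eps); apply: cvgD.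
  by rewrite -(mulr0 ((cM * G + cMMLS) * Num.sqrt D%:R)); apply: cvgMr.
rewrite -[X in _ --> X](add0r eps); apply: cvgD => //; exact: cvg_cst.
Qed.
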